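(* Let $\alpha,\beta\in(0,1)$ satisfy $2\beta+\alpha<1-\exp(-1/36)$. There exists a constant $C>0$ depending only on $\alpha$ and $\beta$ such that the following holds for every $n\ge1$, $\tau>0$, $\eta\in[0,1)$, $I=[\sqrt{1-\eta}\,\tau,\tau]$, and every finite family $\{S_m,m\in\mathcal M_n\}$ of linear subspaces of $\mathbb R^n$, with $\mathcal D_m=\dim S_m$ and $N_m=n-\mathcal D_m$. Let $(\tilde f,\tilde r)$ be a pair of random variables depending on $Y$ only, with values in $\mathbb R^n\times\mathbb R_+$, such that for all $f\in\mathbb R^n$ and $\sigma\in I$ $$\mathbb P_{f,\sigma}[f\in\mathcal B(\tilde f,\tilde r)]\ge1-\beta .$$ (i) For each $m\in\mathcal M_n$, let $r_m$ be a positive number such that for all $\sigma\in I$, $\inf_{f\in S_m}\mathbb P_{f,\sigma}[\tilde r\le r_m]\ge1-\alpha$. Then for all $m\in\mathcal M_n$, $$r_m^2\ge C\max\{\eta N_m,\ \mathcal D_m,\ \sqrt{N_m}\}\,\tau^2 .$$ (ii) For each $f\in\mathbb R^n$, let $r(\alpha,f)$ be a number such that for all $\sigma\in I$, $\mathbb P_{f,\sigma}[\tilde r\le r(\alpha,f)]\ge1-\alpha$. Then $$r^2(\alpha,f)\ge C\max\{\eta n,\sqrt n\}\,\tau^2 .$$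
   Context: $\mathbb P_{f,\sigma}$ is the law of $Y=f+\sigma\varepsilon$ with $f\in\mathbb R^n$, $\sigma>0$ and $\varepsilon$ standard Gaussian in $\mathbb R^n$ (mean $0$, identity covariance). $\mathcal B(x,r)$ is the (closed) Euclidean ball in $\mathbb R^n$ with center $x$ and radius $r$. The variance is not known exactly; it is only known that $\sigma\in I$. *)

(* Defs.v *)
From HB Require Import structures.
From mathcomp Require Import all_boot all_order all_algebra.
From mathcomp Require Import all_classical all_reals all_analysis.
From mathcomp Require Import measurable_realfun.

Set Implicit Arguments.
Unset Strict Implicit.
Unset Printing Implicit Defensive.

Import Order.TTheory GRing.Theory Num.Theory.
Import numFieldNormedType.Exports.

Local Open Scope classical_set_scope.
Local Open Scope ring_scope.

(* R^n is 'rV[R]_n with the sigma-algebra generated by the coordinates, i.e.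
   the Borel sigma-algebra; this is the library's construction on n.-tuple R,
   repeated here because n.-tuple R carries no vector space structure. *)
Section measurable_rV.
Context {R : realType} (n : nat).

Let coors (i : 'I_n) (x : 'rV[R]_n) : R := x ord0 i.

Let rV_set0 : g_sigma_preimage coors set0.
Proof. exact: sigma_algebra0. Qed.

Let rV_setC A : g_sigma_preimage coors A -> g_sigma_preimage coors (~` A).
Proof. exact: sigma_algebraC. Qed.

Let rV_bigcup (F : (set 'rV[R]_n)^nat) :
  (forall i, g_sigma_preimage coors (F i)) ->
  g_sigma_preimage coors (\bigcup_i F i).
Proof. exact: sigma_algebra_bigcup. Qed.

HB.instance Definition _ :=
  @isMeasurable.Build (measure_tuple_display default_measure_display)
  'rV[R]_n (g_sigma_preimage coors) rV_set0 rV_setC rV_bigcup.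

End measurable_rV.

Section measurable_fun_rV.
Context {R : realType} d (T : measurableType d).

Lemma measurable_coord n (i : 'I_n) :
  measurable_fun [set: 'rV[R]_n] (fun x : 'rV[R]_n => x ord0 i).
Proof.
move=> _ A mA; apply: sub_sigma_algebra.
case: n i => [[] []//|n i].
rewrite -bigcup_mkord_ord; exists i; first exact: ltn_ord.
by exists A => //; rewrite inord_val.
Qed.

Lemma measurable_fun_rVP n (f : T -> 'rV[R]_n) :
  measurable_fun [set: T] f <->
  forall i, measurable_fun [set: T] (fun t => f t ord0 i).
Proof.
split=> [mf i|mf]; first exact: measurableT_comp (measurable_coord i) mf.
apply: (@measurability _ _ _ _ _ _
  (\big[setU/set0]_(i < n) preimage_set_system [set: 'rV[R]_n]
    (fun x : 'rV[R]_n => x ord0 i) measurable)) => //.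
case: n => [|n] in f mf *; first by rewrite big_ord0; move=> ? -[B B0]; case: B0.
move=> _ [B + <-]; rewrite -bigcup_mkord_ord => -[i Ii [A mA <-]].
by rewrite setTI; have := mf (inord i) measurableT A mA; rewrite !setTI.
Qed.

End measurable_fun_rV.

Section gaussian_model.
Context {R : realType}.

Definition rV_cons n (p : measurableTypeR R * 'rV[R]_n) : 'rV[R]_n.+1 :=
  \row_i (if unlift ord0 i is Some j then p.2 ord0 j else p.1).

Lemma measurable_rV_cons n : measurable_fun setT (@rV_cons n).
Proof.
apply/measurable_fun_rVP => i; rewrite /rV_cons.
under [X in measurable_fun _ X]eq_fun do rewrite mxE.
case: unliftP => [j|] _; last exact: measurable_fst.
exact: measurableT_comp (measurable_coord j) measurable_snd.
Qed.

HB.instance Definition _ n :=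
  isMeasurableFun.Build _ _ _ _ (@rV_cons n) (@measurable_rV_cons n).

(* Law of a standard Gaussian vector: the n-fold product of the N(0, 1) law. *)
Fixpoint std_gaussian n : probability 'rV[R]_n R :=
  match n with
  | 0 => \d_(0 : 'rV[R]_0)
  | k.+1 => distribution (normal_prob (0 : R) 1 \x std_gaussian k)%E (@rV_cons k)
  end.

Lemma measurable_box n (A : 'I_n -> set R) : (forall i, measurable (A i)) ->
  measurable [set x : 'rV[R]_n | forall i, A i (x ord0 i)].
Proof.
move=> mA; rewrite (_ : [set _ | _] =
    \bigcap_(i in [set: 'I_n]) ((fun x : 'rV[R]_n => x ord0 i) @^-1` A i)).
  apply: fin_bigcap_measurable => // i _; rewrite -[X in measurable X]setTI.
  exact: measurable_coord.
by apply/seteqP; split=> x /= xA; [move=> i _|move=> i]; exact: xA.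
Qed.

Lemma std_gaussian_box n (A : 'I_n -> set R) : (forall i, measurable (A i)) ->
  std_gaussian n [set x | forall i, A i (x ord0 i)] =
  (\prod_(i < n) normal_prob 0 1 (A i))%E.
Proof.
elim: n A => [|n IH] A mA /=.
  by rewrite big_ord0 diracE mem_set// => -[].
rewrite /distribution /pushforward.
rewrite (_ : _ @^-1` _ =
    A ord0 `*` [set x : 'rV[R]_n | forall j, A (lift ord0 j) (x ord0 j)]).
  rewrite product_measure1E.
  - rewrite big_ord_recl; congr (_ * _)%E.
    by apply: (IH (fun j => A (lift ord0 j))) => j; exact: mA.
  - exact: mA.
  - by apply: (measurable_box (A := fun j => A (lift ord0 j))) => j; exact: mA.
apply/seteqP; split=> [[a x] /= H|[a x] /= [H0 H] i].
  split=> [|j]; first by have := H ord0; rewrite mxE unlift_none.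
  by have := H (lift ord0 j); rewrite mxE liftK.
by rewrite mxE; case: unliftP => [j|] ->.
Qed.

Definition observation n (f : 'rV[R]_n) (sigma : R) (eps : 'rV[R]_n) :=
  f + sigma *: eps.

Lemma measurable_observation n (f : 'rV[R]_n) sigma :
  measurable_fun setT (observation f sigma).
Proof.
apply/measurable_fun_rVP => i.
rewrite (_ : (fun _ => _) = (fun e : 'rV[R]_n => f ord0 i + sigma * e ord0 i)).
  apply: measurable_funD => //; apply: measurable_funM => //.
  exact: measurable_coord.
by apply/funext => e; rewrite !mxE.
Qed.

HB.instance Definition _ n (f : 'rV[R]_n) sigma :=
  isMeasurableFun.Build _ _ _ _ (observation f sigma)
    (measurable_observation f sigma).

Definition gaussian_law n (f : 'rV[R]_n) (sigma : R) : probability 'rV[R]_n R :=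
  distribution (std_gaussian n) (observation f sigma).

(* The library's norm and balls on 'rV[R]_n are those of the sup norm. *)
Definition eucl_norm n (x : 'rV[R]_n) : R := Num.sqrt (\sum_i x ord0 i ^+ 2).

Definition eucl_ball n (x : 'rV[R]_n) (r : R) : set 'rV[R]_n :=
  [set y | eucl_norm (y - x) <= r].

End gaussian_model.

(* Main.v *)
Require Import Defs.
From HB Require Import structures.
From mathcomp Require Import all_boot all_order all_algebra.
From mathcomp Require Import all_classical all_reals all_analysis.
From mathcomp Require Import measurable_realfun ring lra.

(* All bounds come from Bayesian comparisons, in which the chi-square
   distance of Gaussian laws is an explicit product of one-dimensional integrals.

   Fix f0 with P_{f0,s}[rtilde <= r] >= 1 - alpha. Give f the prior
   N(f0, l^2 I) with l^2 = (eta + 1/sqrt n) tau^2, at noise level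
   sqrt(1 - eta) tau: the marginal of Y is N(f0, (1 + 1/sqrt n) tau^2 I), at
   total variation distance at most 1/2 from P_{f0,tau}. Hence f0 and f both lie
   in the ball of radius rtilde <= r with constant probability, so that
   |f - f0| <= 2 r, while |f - f0|^2 is at least of order
   n l^2 = (eta n + sqrt n) tau^2. This gives (ii), and with f0 = 0 the terms in
   N_m of (i).

   For the term in D_m, let f = (tau / 2) g B, where the rows of B are an
   orthonormal basis of S_m and g is standard Gaussian. By comparison with P_{0,tau},
   the ball of radius r centered at ftilde contains f with probability at most
   sqrt(2)^D times the largest Gaussian measure of such a ball, plus 1/4, and
   that measure is at most 6^(-D) unless r^2 is of order D tau^2. *)

Set Implicit Arguments.
Unset Strict Implicit.
Unset Printing Implicit Defensive.

Import Order.TTheory GRing.Theory Num.Theory.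
Import numFieldNormedType.Exports.

Local Open Scope classical_set_scope.
Local Open Scope ring_scope.

(** * Integration against a measure given by a density *)

Section integral_density.
Context d (T : measurableType d) (R : realType).
Variables (mu nu : {measure set T -> \bar R}) (g : T -> R).
Hypotheses (mg : measurable_fun setT g) (g0 : forall x, 0 <= g x).
Hypothesis nug : forall A, measurable A -> nu A = (\int[mu]_(x in A) (g x)%:E)%E.

Import HBNNSimple.

(** Monotone convergence along simple functions increasing to [f] reduces both sides to indicators,
    for which the identity is [nug]. *)
Lemma ge0_integral_density (f : T -> \bar R) :
  measurable_fun setT f -> (forall x, (0 <= f x)%E) ->
  (\int[nu]_x f x = \int[mu]_x (f x * (g x)%:E))%E.
Proof.
move=> mf f0; pose f_ := nnsfun_approx measurableT mf.
have cvgf x : EFin \o f_ ^~ x @ \oo --> f x by exact: cvg_nnsfun_approx.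
have ndf x : {homo (fun n => (f_ n x)%:E) : m n / (m <= n)%N >-> (m <= n)%E}.
  by move=> m n mn; rewrite lee_fin; exact/lefP/nd_nnsfun_approx.
transitivity (limn (fun n => \int[nu]_x (f_ n x)%:E)%E).
  rewrite -monotone_convergence//.
  - apply: eq_integral => x _; apply/esym/cvg_lim => //; exact: cvgf.
  - by move=> n; exact/measurable_EFinP/measurable_funP.
  - by move=> n x _; rewrite lee_fin.
rewrite [X in limn X](_ : _ = fun n => \int[mu]_x ((f_ n x)%:E * (g x)%:E))%E.
  rewrite -monotone_convergence//.
  - apply: eq_integral => x _; apply/cvg_lim => //.
    by apply: cvgeZr => //; exact: cvgf.
  - move=> n; apply: emeasurable_funM => //.
      exact/measurable_EFinP/measurable_funP.
    exact/measurable_EFinP.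
  - by move=> n x _; rewrite mule_ge0 ?lee_fin.
  - by move=> x _ m p mp; rewrite lee_wpmul2r// ?lee_fin//; exact: ndf.
apply/funext => n.
under eq_integral do rewrite fimfunE -fsumEFin//.
under [RHS]eq_integral.
  move=> x _; rewrite fimfunE -fsumEFin// ge0_mule_fsuml; last first.
    by move=> y; exact: nnfun_muleindic_ge0.
  over.
rewrite !ge0_integral_fsum//.
- apply: eq_fsbigr => r _; rewrite integralZl_indic_nnsfun// integral_indic//=.
  rewrite setIT nug//.
  have [r0|r0] := leP 0%R r; last first.
    rewrite preimage_nnfun0// integral_set0 mule0 integral0_eq// => x _.
    by rewrite indic0 mulr0 mul0e.
  under [RHS]eq_integral do rewrite EFinM -muleA.
  rewrite ge0_integralZl ?lee_fin//.
  + congr (_ * _)%E; rewrite integral_mkcond; apply: eq_integral => x _.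
    by rewrite patchE indicE; case: ifP => _; rewrite ?mul1e ?mul0e.
  + by apply: emeasurable_funM => //; exact/measurable_EFinP.
  + by move=> x _; rewrite mule_ge0 ?lee_fin.
- move=> r; apply: emeasurable_funM; last exact/measurable_EFinP.
  by apply/measurable_EFinP; exact: measurable_funM.
- by move=> r x _; rewrite mule_ge0 ?lee_fin//; exact: nnfun_muleindic_ge0.
- by move=> r; apply/measurable_EFinP; exact: measurable_funM.
- by move=> r x _; exact: nnfun_muleindic_ge0.
Qed.

End integral_density.

(** * Affine change of variables for Lebesgue measure *)

Section lebesgue_affine.
Context {R : realType}.
Notation mu := (@lebesgue_measure R).

Let measurable_affine (m s : R) :
  measurable_fun setT (fun x : measurableTypeR R => m + s * x : measurableTypeR R).
Proof. by apply: measurable_funD => //; exact: measurable_funM. Qed.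

(** Lebesgue measure is determined by its values on half-open intervals, and there the factor [s]
    restores the length that taking the preimage divides by [s]. *)
Lemma lebesgue_measure_affine (m s : R) (A : set (measurableTypeR R)) :
  0 < s -> measurable A ->
  (s%:E * pushforward mu (fun x : measurableTypeR R => m + s * x)%R A = mu A)%E.
Proof.
move=> s0 mA.
pose aff (x : measurableTypeR R) : measurableTypeR R := m + s * x.
have maff : measurable_fun setT aff := measurable_affine m s.
pose nu (mf : measurable_fun setT aff) : {measure set (measurableTypeR R) -> \bar R} :=
  mscale (NngNum (ltW s0)) (pushforward mu aff).
rewrite -[LHS]/(nu maff maff A); apply/esym/lebesgue_measure_unique => //= _ [[a b]] _ <-.
rewrite /nu/= /mscale/= /pushforward/=.
rewrite (_ : _ @^-1` _ = `](a - m) / s, (b - m) / s]%classic); last first.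
  apply/seteqP; split => x /=; rewrite !in_itv/= /aff ltr_pdivrMr// ler_pdivlMr//.
    by move=> /andP[? ?]; apply/andP; split; lra.
  by move=> /andP[? ?]; apply/andP; split; lra.
rewrite !lebesgue_measure_itv/= !lte_fin ltr_pM2r ?invr_gt0// ltrD2r.
case: ifP => _; last by rewrite mule0.
by rewrite -!EFinB -EFinM; congr _%:E; field; rewrite gt_eqF.
Qed.

Lemma ge0_integral_affine (m s : R) (f : measurableTypeR R -> \bar R) :
  0 < s -> measurable_fun setT f -> (forall x, (0 <= f x)%E) ->
  (s%:E * \int[mu]_x f (m + s * x)%R = \int[mu]_x f x)%E.
Proof.
move=> s0 mf f0.
pose aff (x : measurableTypeR R) : measurableTypeR R := m + s * x.
have maff : measurable_fun setT aff := measurable_affine m s.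
transitivity (s%:E * \int[pushforward mu aff]_x f x)%E.
  by rewrite ge0_integral_pushforward.
pose scaled := @ge0_integral_mscale _ _ R (pushforward mu aff) setT measurableT (NngNum (ltW s0)) f.
rewrite -[LHS](scaled maff mf)//.
apply: eq_measure_integral => /= A mA _.
exact: lebesgue_measure_affine.
Qed.

End lebesgue_affine.

(** * Normal densities and likelihood ratios on the line *)

Section normal_integrals.
Context {R : realType}.
Notation mu := (@lebesgue_measure R).
Notation N01 := (@normal_prob R 0 1).
Implicit Types (m s c : R) (F : measurableTypeR R -> \bar R).

(** Every density is written over the one constant [normal_peak 1], so that quotients of densities
    reduce to exponentials and powers of the scales. *)
Lemma normal_pdf_peak1 m s x : 0 < s ->
  normal_pdf m s x = s^-1 * normal_peak 1 * expR (- (x - m) ^+ 2 / (2 * s ^+ 2)).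
Proof.
move=> s0; rewrite normal_pdfE ?gt_eqF//; congr (_ * _).
  rewrite /normal_peak expr1n mul1r -mulrnAr sqrtrM ?sqr_ge0// sqrtr_sqr.
  by rewrite gtr0_norm// invfM.
by rewrite /normal_fun; congr expR; rewrite mulr_natl.
Qed.

Lemma normal_pdf_gt0 m s x : 0 < s -> 0 < normal_pdf m s x.
Proof.
move=> s0; rewrite normal_pdf_peak1// mulr_gt0 ?expR_gt0//.
apply: mulr_gt0; first by rewrite invr_gt0.
apply: normal_peak_gt0; exact: oner_neq0.
Qed.

Lemma ge0_integral_normal_prob m s F :
  measurable_fun setT F -> (forall x, (0 <= F x)%E) ->
  (\int[normal_prob m s]_x F x = \int[mu]_x (F x * (normal_pdf m s x)%:E))%E.
Proof.
move=> mF F0; apply: ge0_integral_density => //.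
- exact: measurable_normal_pdf.
- by move=> x; exact: normal_pdf_ge0.
Qed.

Lemma ge0_integral_normal_affine m s F : 0 < s ->
  measurable_fun setT F -> (forall x, (0 <= F x)%E) ->
  (\int[N01]_x F (m + s * x)%R = \int[normal_prob m s]_x F x)%E.
Proof.
move=> s0 mF F0; rewrite [RHS]ge0_integral_normal_prob//.
rewrite -[RHS](ge0_integral_affine m s0); last 2 first.
- apply: emeasurable_funM => //; apply/measurable_EFinP.
  exact: measurable_normal_pdf.
- by move=> x; rewrite mule_ge0 ?lee_fin ?normal_pdf_ge0.
have maff : measurable_fun setT
    (fun x : measurableTypeR R => (m + s * x : measurableTypeR R)).
  by apply: measurable_funD => //; exact: measurable_funM.
rewrite ge0_integral_normal_prob//; last exact: measurableT_comp mF maff.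
rewrite -ge0_integralZl ?lee_fin ?(ltW s0)//.
- apply: eq_integral => x _; rewrite muleCA -EFinM; congr (_ * _%:E)%E.
  rewrite !normal_pdf_peak1// invr1 mul1r subr0 -(mulrA s^-1).
  rewrite mulVKf ?gt_eqF//; congr (_ * expR _).
  by field; rewrite gt_eqF.
- apply: emeasurable_funM; first exact: measurableT_comp mF maff.
  apply/measurable_EFinP; apply: (measurableT_comp _ maff).
  exact: measurable_normal_pdf.
- by move=> x _; rewrite mule_ge0 ?lee_fin ?normal_pdf_ge0.
Qed.

(** The likelihood ratio of N(m, s^2) with respect to N(0, 1). *)
Definition normal_ratio m s (x : R) := normal_pdf m s x / normal_pdf 0 1 x.

Lemma normal_ratioE m s x : 0 < s ->
  normal_ratio m s x = s^-1 * expR (x ^+ 2 / 2 - (x - m) ^+ 2 / (2 * s ^+ 2)).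
Proof.
move=> s0; rewrite /normal_ratio !normal_pdf_peak1// invr1 mul1r subr0 expr1n mulr1.
have peak0 : normal_peak 1 != 0 :> R.
  by apply: lt0r_neq0; apply: normal_peak_gt0; exact: oner_neq0.
rewrite mulNr mulNr addrC expRD !expRN.
by field; rewrite peak0 !gt_eqF ?expR_gt0.
Qed.

Lemma measurable_normal_ratio m s : measurable_fun setT (normal_ratio m s).
Proof.
apply: measurable_funM; first exact: measurable_normal_pdf.
apply: continuous_measurable_fun => x.
apply: cvgV; first by rewrite gt_eqF// normal_pdf_gt0.
by apply: continuous_normal_pdf; exact: oner_neq0.
Qed.

Lemma normal_ratio_ge0 m s x : 0 <= normal_ratio m s x.
Proof. by rewrite divr_ge0 ?normal_pdf_ge0. Qed.

Lemma ge0_integral_normal_ratio m s F : 0 < s ->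
  measurable_fun setT F -> (forall x, (0 <= F x)%E) ->
  (\int[N01]_x F (m + s * x)%R = \int[N01]_x (F x * (normal_ratio m s x)%:E))%E.
Proof.
move=> s0 mF F0; rewrite (ge0_integral_normal_affine m s0 mF F0).
rewrite [LHS]ge0_integral_normal_prob// [RHS]ge0_integral_normal_prob//.
- apply: eq_integral => x _; rewrite -muleA -EFinM /normal_ratio divfK//.
  by rewrite gt_eqF// normal_pdf_gt0.
- apply: emeasurable_funM => //; apply/measurable_EFinP.
  exact: measurable_normal_ratio.
- by move=> x; rewrite mule_ge0 ?lee_fin ?normal_ratio_ge0.
Qed.

(** A normal density has integral one. The one-dimensional Gaussian integrals below follow by
    completing the square, which supplies [m], [s] and [c]. *)
Lemma integral_normal_pdf_multiple m s c (psi : R -> R) :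
  measurable_fun setT psi -> (forall x, 0 <= psi x) -> 0 <= c ->
  (forall x, psi x * normal_pdf 0 1 x = c * normal_pdf m s x) ->
  (\int[N01]_x (psi x)%:E = c%:E)%E.
Proof.
move=> mpsi psi0 c0 psiE.
rewrite ge0_integral_normal_prob//; last exact/measurable_EFinP.
under eq_integral do rewrite -EFinM psiE EFinM.
rewrite ge0_integralZl//.
- by rewrite integral_normal_pdf mule1.
- by apply/measurable_EFinP; exact: measurable_normal_pdf.
- by move=> x _; rewrite lee_fin normal_pdf_ge0.
Qed.

Lemma ge0_integral_normalD (a b c : R) F : 0 < a -> 0 < b -> 0 < c ->
  a ^+ 2 + b ^+ 2 = c ^+ 2 ->
  measurable_fun setT F -> (forall x, (0 <= F x)%E) ->
  (\int[N01]_u \int[N01]_v F (a * u + b * v)%R = \int[N01]_w F (c * w)%R)%E.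
Proof.
move=> a0 b0 c0 abc mF F0.
have mZ (k : R) : measurable_fun setT
    (fun x : measurableTypeR R => (k * x : measurableTypeR R)).
  exact: measurable_funM.
have mFc : measurable_fun setT (fun x : measurableTypeR R => F (c * x)).
  exact: measurableT_comp mF (mZ c).
(* Conditionally on c * w = a * u + b * v, w is N(a * u / c, (b / c) ^ 2). *)
transitivity (\int[N01]_u \int[N01]_w
    (F (c * w)%R * (normal_ratio (a * u / c) (b / c) w)%:E))%E.
  apply: eq_integral => u _.
  rewrite -ge0_integral_normal_ratio ?divr_gt0//.
  by apply: eq_integral => v _; congr F; field; rewrite gt_eqF.
have bc0 : 0 < b / c by rewrite divr_gt0.
have mratio : measurable_fun setT (fun uw : measurableTypeR R * measurableTypeR R =>
    normal_ratio (a * uw.1 / c) (b / c) uw.2).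
  under [X in measurable_fun _ X]eq_fun do rewrite normal_ratioE//.
  apply: measurable_funM => //; apply: measurableT_comp => //.
  apply: measurable_funB; apply: measurable_funM => //; apply: measurable_funX.
    exact: measurable_snd.
  apply: measurable_funB; first exact: measurable_snd.
  by do 2 apply: measurable_funM => //; exact: measurable_fst.
rewrite (fubini_tonelli (m1 := N01) (m2 := N01)
  (fun uw : measurableTypeR R * measurableTypeR R =>
     F (c * uw.2)%R * (normal_ratio (a * uw.1 / c) (b / c) uw.2)%:E)%E)/=.
- apply: eq_integral => w _.
  have mw : measurable_fun setT
      (fun u : measurableTypeR R => normal_ratio (a * u / c) (b / c) w).
    exact: (measurableT_comp mratio (pair2_measurable w)).
  rewrite ge0_integralZl//.
  (* By the symmetry of a standard Gaussian pair with correlation [a / c], [u] given [w] is N(a w /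
     c, (b / c)^2), so the ratio integrates to 1 in [u]. *)
  + rewrite (@integral_normal_pdf_multiple (a * w / c) (b / c) 1)//.
    * by rewrite mule1.
    * by move=> u; exact: normal_ratio_ge0.
    * move=> u; rewrite normal_ratioE// !normal_pdf_peak1// invr1 !mul1r subr0.
      rewrite expr1n mulr1 mulrACA -expRD; congr (_ * expR _).
      (* The two exponents differ by a multiple of [a ^+ 2 + b ^+ 2 - c ^+ 2]. *)
      apply/eqP; rewrite -subr_eq0; apply/eqP.
      transitivity ((a ^+ 2 + b ^+ 2 - c ^+ 2) *
        ((w ^+ 2 - u ^+ 2) / (2 * b ^+ 2))); last by rewrite abc subrr mul0r.
      by field; rewrite !gt_eqF.
  + exact/measurable_EFinP.
  + by move=> u _; rewrite lee_fin normal_ratio_ge0.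
- apply: emeasurable_funM; last exact/measurable_EFinP.
  exact: (measurableT_comp mFc measurable_snd).
- by move=> uw; rewrite mule_ge0 ?lee_fin ?normal_ratio_ge0.
Qed.

End normal_integrals.

(** * Integration against the standard Gaussian vector *)

Section std_gaussian_integrals.
Context {R : realType}.
Notation N01 := (@normal_prob R 0 1).
Notation G := (@std_gaussian R).
Implicit Types (a b c t : R).

Lemma measurable_rV_affine n (h : 'rV[R]_n) t :
  measurable_fun setT (fun x : 'rV[R]_n => h + t *: x).
Proof. exact: measurable_observation. Qed.

Lemma measurable_coord_prod n (phi : 'I_n -> R -> R) :
  (forall i, measurable_fun setT (phi i)) ->
  measurable_fun setT (fun x : 'rV[R]_n => \prod_i phi i (x ord0 i)).
Proof.
move=> mphi; apply: measurable_prod => i _.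
exact: measurableT_comp (mphi i) (measurable_coord i).
Qed.

(** Tonelli for the product that defines [G n.+1]; the inductions on the dimension peel off the
    first coordinate through it. *)
Lemma ge0_integral_std_gaussianS n (F : 'rV[R]_n.+1 -> \bar R) :
  measurable_fun setT F -> (forall x, (0 <= F x)%E) ->
  (\int[G n.+1]_x F x = \int[N01]_x \int[G n]_y F (rV_cons (x, y)))%E.
Proof.
move=> mF F0; rewrite [LHS]ge0_integral_distribution//.
rewrite fubini_tonelli1//; last by move=> x; exact: F0.
apply: (measurableT_comp mF); exact: measurable_rV_cons.
Qed.

Lemma measurable_integral_rV_cons n (F : 'rV[R]_n.+1 -> \bar R) :
  measurable_fun setT F -> (forall x, (0 <= F x)%E) ->
  measurable_fun setT
    (fun x : measurableTypeR R => \int[G n]_y F (rV_cons (x, y)))%E.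
Proof.
move=> mF F0; apply: (measurable_fun_fubini_tonelli_F (m2 := G n)
  (fun xy : measurableTypeR R * 'rV[R]_n => F (rV_cons xy))) => //.
by apply: (measurableT_comp mF); exact: measurable_rV_cons.
Qed.

Lemma measurable_rV_cons_r n (x : R) :
  measurable_fun setT (fun y : 'rV[R]_n => rV_cons (x, y)).
Proof.
apply: (measurableT_comp (measurable_rV_cons (n := n))).
exact: (@pair1_measurable _ _ (measurableTypeR R)).
Qed.

Lemma rV_cons0 n (xy : measurableTypeR R * 'rV[R]_n) :
  rV_cons xy ord0 ord0 = xy.1.
Proof. by rewrite mxE unlift_none. Qed.

Lemma rV_cons_lift n (xy : measurableTypeR R * 'rV[R]_n) i :
  rV_cons xy ord0 (lift ord0 i) = xy.2 ord0 i.
Proof. by rewrite mxE liftK. Qed.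

Lemma rV_cons_affine n (h : 'rV[R]_n.+1) t (x : R) (y : 'rV[R]_n) :
  h + t *: rV_cons (x, y) =
  rV_cons (h ord0 ord0 + t * x, (\row_j h ord0 (lift ord0 j)) + t *: y).
Proof. by apply/rowP => i; rewrite !mxE; case: unliftP => [j|] -> //=; rewrite !mxE. Qed.

Lemma ge0_integral_std_gaussian_prod n (phi : 'I_n -> R -> R) (k : 'I_n -> R) :
  (forall i, measurable_fun setT (phi i)) -> (forall i x, 0 <= phi i x) ->
  (forall i, (\int[N01]_x (phi i x)%:E = (k i)%:E)%E) ->
  (\int[G n]_x (\prod_i phi i (x ord0 i))%:E = (\prod_i k i)%:E)%E.
Proof.
elim: n phi k => [|n IH] phi k mphi phi0 phik.
  rewrite integral_dirac//; first by rewrite diracT mul1e !big_ord0.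
  by apply/measurable_EFinP; exact: measurable_coord_prod.
rewrite ge0_integral_std_gaussianS//; last 2 first.
- by apply/measurable_EFinP; exact: measurable_coord_prod.
- by move=> x; rewrite lee_fin prodr_ge0.
transitivity (\int[N01]_x
    ((phi ord0 x)%:E * (\prod_(i < n) k (lift ord0 i))%:E))%E.
  apply: eq_integral => x _.
  under eq_integral.
    move=> y _; rewrite big_ord_recl rV_cons0.
    under eq_bigr do rewrite rV_cons_lift.
    rewrite EFinM /=; over.
  rewrite ge0_integralZl ?lee_fin//.
  - by rewrite (IH (fun i => phi (lift ord0 i)) (fun i => k (lift ord0 i))).
  - apply/measurable_EFinP.
    exact: (measurable_coord_prod (phi := fun i => phi (lift ord0 i))).
  - by move=> y _; rewrite lee_fin prodr_ge0.
rewrite ge0_integralZr//.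
- by rewrite phik -EFinM big_ord_recl.
- by apply/measurable_EFinP; exact: mphi.
- by move=> x _; rewrite lee_fin.
- rewrite lee_fin prodr_ge0// => i _.
  by rewrite -lee_fin -phik integral_ge0// => x _; rewrite lee_fin.
Qed.

(** The density of N(h, t^2 I) with respect to N(0, I) factors over the coordinates: the induction
    hypothesis handles all but the first, and the one-dimensional case handles that one. *)
Lemma ge0_integral_std_gaussian_ratio n (h : 'rV[R]_n) t
    (F : 'rV[R]_n -> \bar R) : 0 < t ->
  measurable_fun setT F -> (forall x, (0 <= F x)%E) ->
  (\int[G n]_x F (h + t *: x)%R =
   \int[G n]_x (F x * (\prod_i normal_ratio (h ord0 i) t (x ord0 i))%:E))%E.
Proof.
move=> t0; elim: n h F => [|n IH] h F mF F0.
  have mr : measurable_fun setT (fun x : 'rV[R]_0 =>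
      (\prod_i normal_ratio (h ord0 i) t (x ord0 i))%:E).
    apply/measurable_EFinP.
    apply: (measurable_coord_prod (phi := fun i => normal_ratio (h ord0 i) t)).
    by move=> i; exact: measurable_normal_ratio.
  rewrite !integral_dirac//.
  - by rewrite big_ord0 mule1 !thinmx0.
  - exact: emeasurable_funM.
  - exact: measurableT_comp mF (measurable_rV_affine _ _).
pose r m (g : 'rV[R]_m) (x : 'rV[R]_m) := \prod_i normal_ratio (g ord0 i) t (x ord0 i).
have mr m (g : 'rV[R]_m) : measurable_fun setT (r m g).
  apply: (measurable_coord_prod (phi := fun i => normal_ratio (g ord0 i) t)).
  by move=> i; exact: measurable_normal_ratio.
have r0 m (g x : 'rV[R]_m) : 0 <= r m g x.
  by apply: prodr_ge0 => i _; exact: normal_ratio_ge0.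
pose h' := \row_j h ord0 (lift ord0 j).
(* [F'] carries the ratio of the last [n] coordinates, so that only a change of variable in the
   first coordinate remains after the induction hypothesis. *)
pose F' (x : 'rV[R]_n.+1) := (F x * (r _ h' (\row_j x ord0 (lift ord0 j)))%:E)%E.
have mF' : measurable_fun setT F'.
  apply: emeasurable_funM => //; apply/measurable_EFinP.
  apply: (measurableT_comp (mr _ _)); apply/measurable_fun_rVP => i.
  under [X in measurable_fun _ X]eq_fun do rewrite mxE.
  exact: measurable_coord.
have F'0 x : (0 <= F' x)%E by rewrite mule_ge0 ?lee_fin.
rewrite (@ge0_integral_std_gaussianS _ (fun x => F (h + t *: x)%R))//; last first.
  exact: measurableT_comp mF (measurable_rV_affine _ _).
rewrite (@ge0_integral_std_gaussianS _ (fun x => F x * (r _ h x)%:E)%E); last 2 first.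
- by apply: emeasurable_funM => //; apply/measurable_EFinP; exact: mr.
- by move=> x; rewrite mule_ge0 ?lee_fin.
transitivity (\int[N01]_x \int[G n]_y F' (rV_cons ((h ord0 ord0 + t * x)%R, y)))%E.
  apply: eq_integral => x _.
  under eq_integral do rewrite rV_cons_affine.
  have mFx := measurableT_comp mF (measurable_rV_cons_r (h ord0 ord0 + t * x)).
  apply: (etrans (IH h' _ mFx (fun=> F0 _))).
  apply: eq_integral => y _; congr (_ * (r _ _ _)%:E)%E.
  by apply/rowP => j; rewrite mxE rV_cons_lift.
have mI := measurable_integral_rV_cons mF' F'0.
have I0 (x : R) : (0 <= \int[G n]_y F' (rV_cons (x, y)))%E by exact: integral_ge0.
apply: (etrans (ge0_integral_normal_ratio (h ord0 ord0) t0 mI I0)).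
apply: eq_integral => x _; rewrite -ge0_integralZr//.
- apply: eq_integral => y _; rewrite /F' -muleA -EFinM; congr (_ * _%:E)%E.
    rewrite /r [in RHS]big_ord_recl rV_cons0 mulrC; congr (_ * _).
    by apply: eq_bigr => i _; rewrite !mxE liftK.
- exact: measurableT_comp mF' (measurable_rV_cons_r _).
- by rewrite lee_fin normal_ratio_ge0.
Qed.

Lemma rV_consZ n c (x : R) (y : 'rV[R]_n) :
  c *: rV_cons (x, y) = rV_cons (c * x, c *: y).
Proof. by apply/rowP => i; rewrite !mxE; case: unliftP => [j|] _ //=; rewrite !mxE. Qed.

Lemma rV_consD n (x x' : R) (y y' : 'rV[R]_n) :
  rV_cons (x, y) + rV_cons (x', y') = rV_cons (x + x', y + y').
Proof. by apply/rowP => i; rewrite !mxE; case: unliftP => [j|] _ //=; rewrite !mxE. Qed.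

Lemma measurable_fun_rVD d (T : measurableType d) n (f g : T -> 'rV[R]_n) :
  measurable_fun setT f -> measurable_fun setT g ->
  measurable_fun setT (fun x => f x + g x).
Proof.
move=> /measurable_fun_rVP mf /measurable_fun_rVP mg; apply/measurable_fun_rVP => i.
by under [X in measurable_fun _ X]eq_fun do rewrite mxE; exact: measurable_funD.
Qed.

Lemma measurable_fun_rVZ d (T : measurableType d) n c (f : T -> 'rV[R]_n) :
  measurable_fun setT f -> measurable_fun setT (fun x => c *: f x).
Proof.
move=> /measurable_fun_rVP mf; apply/measurable_fun_rVP => i.
by under [X in measurable_fun _ X]eq_fun do rewrite mxE; exact: measurable_funM.
Qed.

Lemma integral_std_gaussian0 (F : 'rV[R]_0 -> \bar R) :
  (\int[G 0]_x F x = F 0%R)%E.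
Proof.
transitivity (\int[G 0]_x cst (F 0%R) x)%E.
  by apply: eq_integral => x _; rewrite [x]thinmx0.
by rewrite integral_cst// [X in (_ * X)%E]probability_setT mule1.
Qed.

(** This computes Bayesian mixtures: a Gaussian prior on the signal and Gaussian noise give a
    Gaussian marginal with the variances added. Induction on the dimension reduces it to
    [ge0_integral_normalD]. *)
Lemma ge0_integral_std_gaussianD n a b c (F : 'rV[R]_n -> \bar R) :
  0 < a -> 0 < b -> 0 < c -> a ^+ 2 + b ^+ 2 = c ^+ 2 ->
  measurable_fun setT F -> (forall x, (0 <= F x)%E) ->
  (\int[G n]_u \int[G n]_v F (a *: u + b *: v)%R = \int[G n]_w F (c *: w)%R)%E.
Proof.
move=> a0 b0 c0 abc; elim: n F => [|n IH] F mF F0.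
  by rewrite !integral_std_gaussian0 !scaler0 addr0.
have mFD : measurable_fun setT (fun uv : 'rV[R]_n.+1 * 'rV[R]_n.+1 =>
    F (a *: uv.1 + b *: uv.2)).
  apply: (measurableT_comp mF); apply: measurable_fun_rVD.
    by apply: measurable_fun_rVZ; exact: measurable_fst.
  by apply: measurable_fun_rVZ; exact: measurable_snd.
have mu1 := measurable_fun_fubini_tonelli_F (m2 := G n.+1) _ mFD (fun=> F0 _).
have u10 u : (0 <= \int[G n.+1]_v F (a *: u + b *: v)%R)%E by exact: integral_ge0.
rewrite (ge0_integral_std_gaussianS mu1 u10).
have mFc : measurable_fun setT (fun w : 'rV[R]_n.+1 => F (c *: w)).
  by apply: (measurableT_comp mF); apply: measurable_fun_rVZ; exact: measurable_id.
rewrite (ge0_integral_std_gaussianS mFc (fun=> F0 _)).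
pose H (z : measurableTypeR R) := (\int[G n]_w F (rV_cons (z, (c *: w)%R)))%E.
have mH : measurable_fun setT H.
  apply: (measurable_fun_fubini_tonelli_F (m2 := G n)
    (fun zw : measurableTypeR R * 'rV[R]_n => F (rV_cons (zw.1, c *: zw.2)))) => //.
  apply: (measurableT_comp mF); apply: (measurableT_comp (@measurable_rV_cons R n)).
  apply/measurable_fun_pairP; split; first exact: measurable_fst.
  by apply: measurable_fun_rVZ; exact: measurable_snd.
have H0 z : (0 <= H z)%E by exact: integral_ge0.
transitivity (\int[N01]_x \int[N01]_x' H (a * x + b * x')%R)%E; last first.
  rewrite (ge0_integral_normalD a0 b0 c0 abc mH H0).
  by apply: eq_integral => x _; apply: eq_integral => y _; rewrite rV_consZ.
apply: eq_integral => x _.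
transitivity (\int[G n]_y \int[N01]_x' \int[G n]_y'
    F (rV_cons ((a * x + b * x')%R, (a *: y + b *: y')%R)))%E.
  apply: eq_integral => y _.
  have mv : measurable_fun setT (fun v : 'rV[R]_n.+1 => F (a *: rV_cons (x, y) + b *: v)).
    apply: (measurableT_comp mF); apply: measurable_fun_rVD => //.
    by apply: measurable_fun_rVZ; exact: measurable_id.
  apply: (etrans (ge0_integral_std_gaussianS mv (fun=> F0 _))).
  apply: eq_integral => x' _; apply: eq_integral => y' _.
  by rewrite !rV_consZ rV_consD.
(* Exchanging [y] and [x'] puts the two tails [y] and [y'] innermost, where the induction hypothesis
   merges them and leaves [H]. *)
rewrite (fubini_tonelli (m1 := G n) (m2 := N01)
  (fun yx : 'rV[R]_n * measurableTypeR R => \int[G n]_y'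
    F (rV_cons ((a * x + b * yx.2)%R, (a *: yx.1 + b *: y')%R)))%E).
- apply: eq_integral => x' _ /=.
  have mFx := measurableT_comp mF (measurable_rV_cons_r (a * x + b * x')).
  exact: (IH _ mFx (fun=> F0 _)).
- apply: (measurable_fun_fubini_tonelli_F (m2 := G n)
    (fun yxy : ('rV[R]_n * measurableTypeR R) * 'rV[R]_n =>
      F (rV_cons (a * x + b * yxy.1.2, a *: yxy.1.1 + b *: yxy.2)))) => //.
  apply: (measurableT_comp mF); apply: (measurableT_comp (@measurable_rV_cons R n)).
  have m1 := @measurable_fst _ _ ('rV[R]_n * measurableTypeR R)%type 'rV[R]_n.
  apply/measurable_fun_pairP; split; last first.
    apply: measurable_fun_rVD; apply: measurable_fun_rVZ; last exact: measurable_snd.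
    exact: (measurableT_comp measurable_fst m1).
  apply: measurable_funD => //; apply: measurable_funM => //.
  exact: (measurableT_comp measurable_snd m1).
- by move=> yx; exact: integral_ge0.
Qed.

End std_gaussian_integrals.

(** * Second moments of likelihood ratios and small-ball bounds *)

Section gaussian_estimates.
Context {R : realType}.
Notation N01 := (@normal_prob R 0 1).
Notation G := (@std_gaussian R).
Implicit Types (h t c v : R).

Lemma measurable_normal_ratio_sqr h t :
  measurable_fun setT (fun x => normal_ratio h t x ^+ 2).
Proof. by apply: measurable_funX; exact: measurable_normal_ratio. Qed.

(** This second moment is one plus the chi-square distance; squaring the ratio moves the center from
    [h] to [2 * h]. *)
Lemma integral_normal_ratio_sqr_shift h :
  (\int[N01]_x (normal_ratio h 1 x ^+ 2)%:E = (expR (h ^+ 2))%:E)%E.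
Proof.
apply: (@integral_normal_pdf_multiple _ (2 * h) 1).
- exact: measurable_normal_ratio_sqr.
- by move=> x; exact: sqr_ge0.
- exact: expR_ge0.
- move=> x; rewrite normal_ratioE// !normal_pdf_peak1// invr1 !mul1r.
  rewrite [expR _ ^+ 2]expr2 -expRD mulrCA -expRD.
  by rewrite [RHS]mulrCA -[in RHS]expRD; congr (_ * expR _); field.
Qed.

(** The smaller variance is compared with the larger one: this second moment is finite for every
    [v > 0], whereas that of the reverse ratio diverges at [v = 1], the value met when n = 1. *)
Lemma integral_normal_ratio_sqr_scale v : 0 < v ->
  (\int[N01]_x (normal_ratio 0 (Num.sqrt (1 + v))^-1 x ^+ 2)%:E =
   ((1 + v) / Num.sqrt (1 + 2 * v))%:E)%E.
Proof.
move=> v0; have u0 : 0 < Num.sqrt (1 + v) by rewrite sqrtr_gt0; lra.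
have w0 : 0 < Num.sqrt (1 + 2 * v) by rewrite sqrtr_gt0; lra.
have u2 : Num.sqrt (1 + v) ^+ 2 = 1 + v by rewrite sqr_sqrtr//; lra.
have w2 : Num.sqrt (1 + 2 * v) ^+ 2 = 1 + 2 * v by rewrite sqr_sqrtr//; lra.
apply: (@integral_normal_pdf_multiple _ 0 (Num.sqrt (1 + 2 * v))^-1).
- exact: measurable_normal_ratio_sqr.
- by move=> x; exact: sqr_ge0.
- by rewrite divr_ge0//; lra.
- move=> x; rewrite normal_ratioE ?invr_gt0// !normal_pdf_peak1 ?invr_gt0//.
  rewrite !invrK invr1 !mul1r !subr0 expr1n mulr1 !exprVn u2 w2 exprMn u2.
  set a := expR _; set b := expR _; set e := expR _.
  have -> : e = a ^+ 2 * b.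
    by rewrite expr2 -!expRD; congr expR; field; apply/andP; split; lra.
  by field; rewrite gt_eqF.
Qed.

(** The prior mean of one coordinate's factor in the chi-square term exp(|g|^2 / 4); it is the
    source of sqrt(2)^D. *)
Lemma integral_normal_expR_sqr :
  (\int[N01]_x (expR (x ^+ 2 / 4))%:E = (Num.sqrt 2)%:E :> \bar R)%E.
Proof.
have s0 : 0 < Num.sqrt 2 :> R by rewrite sqrtr_gt0.
apply: (@integral_normal_pdf_multiple _ 0 (Num.sqrt 2)).
- by apply: measurableT_comp => //; apply: measurable_funM.
- by move=> x; exact: expR_ge0.
- exact: ltW.
- move=> x; rewrite !normal_pdf_peak1// invr1 !mul1r !subr0 sqr_sqrtr// expr1n.
  set a := expR _; set b := expR _; set e := expR _.
  have -> : e = a * b by rewrite -!expRD; congr expR; field.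
  by field; rewrite gt_eqF.
Qed.

(** The factor of one coordinate in a Chernoff bound with parameter 32, where 1/4 = 32/128 matches
    the squared radius n/128. Completing the square gives the variance 1/65. *)
Lemma integral_normal_small_ball (b : R) :
  (\int[N01]_x (expR (1 / 4 - 32 * (x - b) ^+ 2))%:E =
   (expR (1 / 4 - 32 / 65 * b ^+ 2) / Num.sqrt 65)%:E)%E.
Proof.
have s0 : 0 < Num.sqrt 65 :> R by rewrite sqrtr_gt0.
apply: (@integral_normal_pdf_multiple _ (64 / 65 * b) (Num.sqrt 65)^-1).
- apply: measurableT_comp => //; apply: measurable_funB => //.
  by apply: measurable_funM => //; apply: measurable_funX; exact: measurable_funB.
- by move=> x; exact: expR_ge0.
- by rewrite divr_ge0 ?expR_ge0// ltW.
- move=> x; rewrite !normal_pdf_peak1 ?invr_gt0// invrK invr1 !mul1r !subr0.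
  rewrite exprVn sqr_sqrtr// expr1n.
  set a := expR _; set e := expR _; set f := expR _; set g := expR _.
  have af : a * e = f * g by rewrite -!expRD; congr expR; field.
  by rewrite mulrCA af; field; rewrite gt_eqF.
Qed.

(** From exp(-1/4) >= 3/4 comes exp(1/4) <= 4/3, while sqrt(65) >= 8; the term in [b] only lowers
    the exponent. *)
Lemma small_ball_factor_le (b : R) :
  expR (1 / 4 - 32 / 65 * b ^+ 2) / Num.sqrt 65 <= 6^-1.
Proof.
have s0 : 8 <= Num.sqrt 65 :> R.
  by rewrite -[leLHS]ger0_norm// -sqrtr_sqr ler_sqrt//; lra.
rewrite ler_pdivrMr; last lra.
have e1 : expR (1 / 4 - 32 / 65 * b ^+ 2) <= 4 / 3.
  apply: (@le_trans _ _ (expR (1 / 4))).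
    by rewrite ler_expR; have := sqr_ge0 b; lra.
  have := expR_ge1Dx (- (1 / 4) : R); rewrite expRN => e2.
  have e0 := expR_gt0 (1 / 4 : R).
  rewrite -[leLHS]invrK invf_ple ?posrE ?invr_gt0//; lra.
lra.
Qed.

Lemma measurable_sqdist n (b : 'rV[R]_n) :
  measurable_fun setT (fun x : 'rV[R]_n => \sum_i (x ord0 i - b ord0 i) ^+ 2).
Proof.
apply: measurable_sum => i; apply: measurable_funX; apply: measurable_funB => //.
exact: measurable_coord.
Qed.

(* Chernoff: the indicator of the ball is at most the product over i of
   exp(1/4 - 32 (x_i - b_i)^2). *)
Lemma std_gaussian_small_ball n (b : 'rV[R]_n) :
  (G n [set x : 'rV[R]_n | \sum_i (x ord0 i - b ord0 i) ^+ 2 <= n%:R / 128]%R <=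
   ((6^-1) ^+ n)%:E)%E.
Proof.
set A := [set _ | _].
have mA : measurable A.
  rewrite -[A]setTI; apply: measurable_fun_le => //.
  exact: measurable_sqdist.
have mexp (i : 'I_n) : measurable_fun setT
    (fun x : R => expR (1 / 4 - 32 * (x - b ord0 i) ^+ 2)).
  apply: measurableT_comp => //; apply: measurable_funB => //.
  by apply: measurable_funM => //; apply: measurable_funX; exact: measurable_funB.
rewrite -[A in G n A]setIT -integral_indic//.
apply: (@le_trans _ _ (\int[G n]_x
    (\prod_i expR (1 / 4 - 32 * (x ord0 i - b ord0 i) ^+ 2))%:E)%E).
  apply: ge0_le_integral => //.
  - by apply/measurable_EFinP; exact: measurable_indic.
  - by apply/measurable_EFinP; exact: (measurable_coord_prod mexp).
  - move=> x _; rewrite lee_fin -expR_sum indicE.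
    case: (boolP (x \in A)) => [/set_mem xA|_]; last exact: expR_ge0.
    (* On the ball the exponents sum to n/4 - 32 |x - b|^2 >= 0. *)
    rewrite -[leLHS]expR0 ler_expR sumrB -[X in _ - X]mulr_sumr.
    rewrite sumr_const card_ord -[_ *+ n]mulr_natr.
    by move: xA; rewrite /A/=; lra.
have /= -> := ge0_integral_std_gaussian_prod mexp (fun i x => expR_ge0 _)
  (fun i => integral_normal_small_ball (b ord0 i)).
rewrite lee_fin -[X in _ <= _ ^+ X]card_ord -prodr_const.
apply: ler_prod => i _; rewrite small_ball_factor_le andbT.
by rewrite divr_ge0 ?expR_ge0.
Qed.

(* L <= c + L^2 / (4 c) for the likelihood ratio L. *)
Lemma std_gaussian_affine_preimage_le n (h : 'rV[R]_n) t c (k : 'I_n -> R) A :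
  0 < t -> 0 < c ->
  (forall i, (\int[N01]_x (normal_ratio (h ord0 i) t x ^+ 2)%:E = (k i)%:E)%E) ->
  measurable A ->
  (G n ((fun x => h + t *: x)%R @^-1` A) <=
   c%:E * G n A + ((\prod_i k i) / (4 * c))%:E)%E.
Proof.
move=> t0 c0 kE mA.
have mphi (i : 'I_n) := measurable_normal_ratio (h ord0 i) t.
have mphi2 (i : 'I_n) := measurable_normal_ratio_sqr (h ord0 i) t.
pose L (x : 'rV[R]_n) := \prod_i normal_ratio (h ord0 i) t (x ord0 i).
pose L2 (x : 'rV[R]_n) := \prod_i normal_ratio (h ord0 i) t (x ord0 i) ^+ 2.
have mL2 : measurable_fun setT L2 := measurable_coord_prod mphi2.
have L20 x : 0 <= L2 x by apply: prodr_ge0 => i _; exact: sqr_ge0.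
have mhA : measurable ((fun x => h + t *: x)%R @^-1` A).
  by rewrite -[X in measurable X]setTI; exact: measurable_rV_affine.
have c4 : 0 <= (4 * c)^-1 by rewrite invr_ge0; lra.
rewrite -[X in G n X]setIT -integral_indic//.
have mA1 : measurable_fun setT (fun x : 'rV[R]_n => (\1_A x : R)%:E).
  by apply/measurable_EFinP; exact: measurable_indic.
have A10 (x : 'rV[R]_n) : (0 <= (\1_A x : R)%:E)%E by rewrite lee_fin.
rewrite [leLHS](ge0_integral_std_gaussian_ratio h t0 mA1 A10).
apply: (@le_trans _ _ (\int[G n]_x
    (c%:E * (\1_A x)%:E + (4 * c)^-1%:E * (L2 x)%:E))%E).
  apply: ge0_le_integral => //.
  - by move=> x _; rewrite mule_ge0// lee_fin prodr_ge0// => i _; exact: normal_ratio_ge0.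
  - apply: emeasurable_funM => //; apply/measurable_EFinP.
    exact: measurable_coord_prod mphi.
  - by apply: emeasurable_funD; apply: emeasurable_funM => //; exact/measurable_EFinP.
  - move=> x _; rewrite -!EFinM -EFinD lee_fin -/(L x).
    have -> : L2 x = L x ^+ 2 by rewrite /L2 /L prodrXl.
    have L0 : 0 <= L x by apply: prodr_ge0 => i _; exact: normal_ratio_ge0.
    have AMGM : L x <= c + (4 * c)^-1 * L x ^+ 2.
      rewrite -subr_ge0 (_ : _ - _ = (L x - 2 * c) ^+ 2 / (4 * c)); last first.
        by field; rewrite gt_eqF.
      by rewrite mulr_ge0 ?sqr_ge0.
    rewrite indicE; case: (x \in A); rewrite ?mulr1 ?mul1r ?mulr0 ?mul0r ?add0r//.
    by rewrite mulr_ge0 ?sqr_ge0.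
rewrite ge0_integralD//; last 4 first.
- by move=> x _; rewrite mule_ge0// lee_fin ltW.
- exact: emeasurable_funM.
- by move=> x _; rewrite mule_ge0 ?lee_fin.
- by apply: emeasurable_funM => //; exact/measurable_EFinP.
rewrite ge0_integralZl ?lee_fin ?(ltW c0)// integral_indic// setIT.
rewrite ge0_integralZl ?lee_fin//; last 2 first.
- exact/measurable_EFinP.
- by move=> x _; rewrite lee_fin.
have /= -> := ge0_integral_std_gaussian_prod mphi2 (fun i x => sqr_ge0 _) kE.
by rewrite -EFinM mulrC.
Qed.

End gaussian_estimates.

(** * The Euclidean norm: measurability and the diameter of a ball *)

Section euclidean.
Context {R : realType}.

Lemma measurable_eucl_norm n : measurable_fun setT (@eucl_norm R n).
Proof.
apply: measurableT_comp; first by apply: continuous_measurable_fun; exact: sqrt_continuous.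
by apply: measurable_sum => i; apply: measurable_funX; exact: measurable_coord.
Qed.

Lemma eucl_norm_le n (x : 'rV[R]_n) r :
  eucl_norm x <= r -> \sum_i x ord0 i ^+ 2 <= r ^+ 2.
Proof.
move=> xr; have s0 : 0 <= \sum_i x ord0 i ^+ 2 by apply: sumr_ge0 => i _; exact: sqr_ge0.
rewrite -(sqr_sqrtr s0) ler_sqr ?nnegrE ?sqrtr_ge0//.
by apply: le_trans xr; exact: sqrtr_ge0.
Qed.

(** In each coordinate, 2 (x - z)^2 + 2 (y - z)^2 exceeds (x - y)^2 by the square (x + y - 2
    z)^2. *)
Lemma eucl_norm_leB n (x y z : 'rV[R]_n) r : eucl_norm (x - z) <= r ->
  eucl_norm (y - z) <= r -> \sum_i (x ord0 i - y ord0 i) ^+ 2 <= 4 * r ^+ 2.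
Proof.
move=> /eucl_norm_le xz /eucl_norm_le yz.
apply: (@le_trans _ _ (2 * \sum_i (x - z) ord0 i ^+ 2 + 2 * \sum_i (y - z) ord0 i ^+ 2)); last lra.
rewrite !mulr_sumr -big_split/=; apply: ler_sum => i _; rewrite !mxE.
by have := sqr_ge0 (x ord0 i + y ord0 i - 2 * z ord0 i); lra.
Qed.

Lemma measurable_eucl_norm_le d (T : measurableType d) n
    (f g : T -> 'rV[R]_n) (r : T -> R) :
  measurable_fun setT f -> measurable_fun setT g -> measurable_fun setT r ->
  measurable [set x | eucl_norm (f x - g x) <= r x].
Proof.
move=> mf mg mr; rewrite -[X in measurable X]setTI; apply: measurable_fun_le => //.
apply: (measurableT_comp (@measurable_eucl_norm n)).
apply: measurable_fun_rVD => //.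
by under [X in measurable_fun _ X]eq_fun do rewrite -scaleN1r; exact: measurable_fun_rVZ.
Qed.

End euclidean.

(** * Union bound and complements *)

Section probability_bounds.
Context d (T : measurableType d) (R : realType) (P : probability T R).

Lemma probability_setI_ge (A B : set T) (a b : R) :
  measurable A -> measurable B ->
  ((1 - a)%:E <= P A)%E -> ((1 - b)%:E <= P B)%E ->
  ((1 - a - b)%:E <= P (A `&` B))%E.
Proof.
move=> mA mB Aa Bb.
have mAB : measurable (A `&` B) by exact: measurableI.
have PE (C : set T) : measurable C -> P C = (fine (P C))%:E.
  by move=> mC; rewrite fineK// fin_num_measure.
have cC (C : set T) : measurable C -> P (~` C) = (1 - fine (P C))%:E.
  by move=> mC; rewrite probability_setC// EFinB -PE.
have : (P (~` (A `&` B)) <= P (~` A) + P (~` B))%E.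
  rewrite setCI; apply: measureU2; exact: measurableC.
rewrite !cC// -EFinD lee_fin.
move: Aa Bb; rewrite (PE _ mA) (PE _ mB) (PE _ mAB) !lee_fin; lra.
Qed.

Lemma probability_setC_le (A : set T) (a : R) : measurable A ->
  ((1 - a)%:E <= P A)%E -> (P (~` A) <= a%:E)%E.
Proof.
move=> mA; rewrite probability_setC// -(fineK (fin_num_measure P _ mA)).
by rewrite -EFinB !lee_fin; lra.
Qed.

End probability_bounds.

(** * The radius forced by the unknown variance *)

Section confidence_ball.
Context {R : realType}.
Notation G := (@std_gaussian R).
Variables (n : nat) (ftilde : {mfun 'rV[R]_n >-> 'rV[R]_n})
  (rtilde : {mfun 'rV[R]_n >-> R}).

Lemma measurable_covered (f : 'rV[R]_n) :
  measurable [set y | eucl_ball (ftilde y) (rtilde y) f].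
Proof.
exact: measurable_eucl_norm_le.
Qed.

Lemma measurable_radius_le (r : R) : measurable [set y | rtilde y <= r].
Proof. by rewrite -[X in measurable X]setTI; apply: measurable_fun_le. Qed.

Notation covered f := [set y | eucl_ball (ftilde y) (rtilde y) f].

(** Either [f] is within 2 r of [f0] and the indicator is 1, or no ball of radius at most [r]
    contains both; in that case the event forces the ball to miss [f], which has probability at most
    [beta]. *)
Lemma gaussian_law_small_radius_le (f0 f : 'rV[R]_n) (sigma beta r : R) :
  ((1 - beta)%:E <= gaussian_law f sigma (covered f))%E ->
  (gaussian_law f sigma (covered f0 `&` [set y | (rtilde y <= r)%R]) <=
   beta%:E + (\1_[set g : 'rV[R]_n |
     (\sum_i (f ord0 i - g ord0 i) ^+ 2 <= 4 * r ^+ 2)%R] f0)%:E)%E.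
Proof.
move=> cov; have mf := measurable_covered f; rewrite indicE.
case: (boolP (f0 \in _)) => [_|/negP far].
  apply: (le_trans (probability_le1 _ _)).
    by apply: measurableI; [exact: measurable_covered|exact: measurable_radius_le].
  rewrite -EFinD lee_fin lerDr.
  have := probability_le1 (gaussian_law f sigma) mf.
  by move/(le_trans cov); rewrite lee_fin; lra.
rewrite adde0; apply: le_trans (probability_setC_le mf cov).
apply: le_measure; rewrite ?inE.
- by apply: measurableI; [exact: measurable_covered|exact: measurable_radius_le].
- exact: measurableC.
- move=> y [f0y ry] fy; apply: far; apply/mem_set => /=.
  by apply: (@eucl_norm_leB _ _ _ _ (ftilde y)); apply: le_trans ry.
Qed.

(** Since (1 + v)^2 / (1 + 2 v) <= 1 + v^2 <= exp(1/m), the square of the left side is at most e,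
    and e <= (4/3)^4 < 4. *)
Lemma variance_ratio_le m (v : R) : (0 < m)%N -> 0 < v -> v ^+ 2 = m%:R^-1 ->
  ((1 + v) / Num.sqrt (1 + 2 * v)) ^+ m <= 2.
Proof.
move=> m0 v0 v2.
have w0 : 0 < 1 + 2 * v by lra.
have q0 : 0 <= (1 + v) / Num.sqrt (1 + 2 * v) by rewrite divr_ge0 ?sqrtr_ge0//; lra.
have q2 : ((1 + v) / Num.sqrt (1 + 2 * v)) ^+ 2 <= expR (m%:R^-1).
  apply: le_trans (expR_ge1Dx _); rewrite expr_div_n sqr_sqrtr -?v2; last exact: ltW.
  rewrite ler_pdivrMr// -subr_ge0 (_ : _ - _ = 2 * v ^+ 3); last by ring.
  by rewrite mulr_ge0// exprn_ge0// ltW.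
rewrite -ler_sqr ?nnegrE ?exprn_ge0// -exprM mulnC exprM.
apply: (@le_trans _ _ (expR (m%:R^-1) ^+ m)).
  by rewrite lerXn2r ?nnegrE ?exprn_ge0 ?expR_ge0.
rewrite -expRM_natr mulVf ?pnatr_eq0 -?lt0n//.
have e1 : expR (- (1 / 4)) >= 3 / 4 :> R by apply: le_trans (expR_ge1Dx _); lra.
have e4 : expR (- (1 / 4)) ^+ 4 = (expR 1)^-1 :> R.
  by rewrite -expRM_natr -expRN; congr expR; field.
have : (3 / 4) ^+ 4 <= (expR 1)^-1 :> R.
  by rewrite -e4 lerXn2r// nnegrE ?expR_ge0//; lra.
rewrite -[leRHS]mul1r ler_pdivlMr ?expR_gt0//; lra.
Qed.

(* The prior N(f0, lambda^2 I) and the noise level sqrt(1 - eta) tau give the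
   mixture N(f0, (1 + 1/sqrt n) tau^2 I), which is close to N(f0, tau^2 I). *)
Lemma radius_lower_bound (f0 : 'rV[R]_n) (tau eta alpha beta r : R) :
  let sigma := Num.sqrt (1 - eta) * tau in
  (0 < n)%N -> 0 < tau -> 0 <= eta < 1 -> 2 * beta + alpha < 1 / 36 ->
  ((1 - beta)%:E <= gaussian_law f0 tau (covered f0))%E ->
  (forall f, ((1 - beta)%:E <= gaussian_law f sigma (covered f))%E) ->
  ((1 - alpha)%:E <= gaussian_law f0 tau [set y | (rtilde y <= r)%R])%E ->
  (eta * n%:R + Num.sqrt n%:R) * tau ^+ 2 <= 512 * r ^+ 2.
Proof.
move=> sigma n0 tau0 /andP[eta0 eta1] ab cov0 cov rad.
rewrite leNgt; apply/negP => small.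
set A := covered f0 `&` [set y | (rtilde y <= r)%R].
have mA : measurable A.
  by apply: measurableI; [exact: measurable_covered|exact: measurable_radius_le].
have PA := probability_setI_ge (measurable_covered f0) (measurable_radius_le r) cov0 rad.
(* Here n v^2 = 1 keeps the chi-square term bounded, while n v = sqrt n is the order sought. *)
pose v : R := (Num.sqrt n%:R)^-1.
have n0R : 0 < n%:R :> R by rewrite ltr0n.
have sn0 : 0 < Num.sqrt n%:R :> R by rewrite sqrtr_gt0.
have v0 : 0 < v by rewrite invr_gt0.
have vn : v * n%:R = Num.sqrt n%:R.
  by rewrite -{1}(sqr_sqrtr (ltW n0R)) /v expr2 mulKf// gt_eqF.
pose s := Num.sqrt (1 + v).
have s0 : 0 < s by rewrite sqrtr_gt0; lra.
have s2 : s ^+ 2 = 1 + v by rewrite sqr_sqrtr//; lra.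
(* Chosen so that [lambda ^+ 2 + sigma ^+ 2] equals [(1 + v) * tau ^+ 2], the variance of the
   mixture. *)
pose lambda := Num.sqrt (eta + v) * tau.
have lambda0 : 0 < lambda by rewrite mulr_gt0// sqrtr_gt0; lra.
have lambda2 : lambda ^+ 2 = (eta + v) * tau ^+ 2 by rewrite exprMn sqr_sqrtr//; lra.
have sigma0 : 0 < sigma by rewrite mulr_gt0// sqrtr_gt0; lra.
have sigma2 : sigma ^+ 2 = (1 - eta) * tau ^+ 2 by rewrite exprMn sqr_sqrtr//; lra.
have ts0 : 0 < tau * s by rewrite mulr_gt0.
have mobs (f : 'rV[R]_n) t (B : set 'rV[R]_n) : measurable B ->
    measurable ((fun x => f + t *: x) @^-1` B).
  by move=> mB; rewrite -[X in measurable X]setTI; exact: measurable_rV_affine.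
(* In units of the mixture's scale [tau * s], the law at noise level [tau] has scale [s^-1]. With
   [c = 1] and second moment at most 2, the comparison costs 2/4. *)
have step1 : (gaussian_law f0 tau A <=
    G n ((fun x => f0 + (tau * s) *: x)%R @^-1` A) + (2^-1)%:E)%E.
  have sV0 : 0 < s^-1 by rewrite invr_gt0.
  have kE (i : 'I_n) : (\int[normal_prob 0 1]_x
      (normal_ratio ((0 : 'rV[R]_n) ord0 i) s^-1 x ^+ 2)%:E =
      ((1 + v) / Num.sqrt (1 + 2 * v))%:E)%E.
    by rewrite mxE; exact: integral_normal_ratio_sqr_scale.
  have := std_gaussian_affine_preimage_le sV0 ltr01 kE (mobs f0 (tau * s) _ mA).
  rewrite mul1e prodr_const card_ord mulr1.
  rewrite (_ : _ @^-1` (_ @^-1` A) = observation f0 tau @^-1` A); last first.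
    apply/seteqP; split=> x /=; rewrite /observation add0r scalerA mulfK ?gt_eqF//.
  move/le_trans; apply; rewrite leeD2l// lee_fin.
  have v2 : v ^+ 2 = n%:R^-1 by rewrite exprVn sqr_sqrtr// ltW.
  by have := variance_ratio_le n0 v0 v2; lra.
(* If f = f0 + lambda u is within 2 r of f0, then [u] lies in [D], because [small] says that 512 r^2
   < n lambda^2. *)
pose D := [set g : 'rV[R]_n | \sum_i (g ord0 i - (0 : 'rV[R]_n) ord0 i) ^+ 2 <= n%:R / 128].
have mD : measurable D.
  by rewrite -[X in measurable X]setTI; apply: measurable_fun_le => //; exact: measurable_sqdist.
have step2 : (G n ((fun x => f0 + (tau * s) *: x)%R @^-1` A) <=
    beta%:E + G n D)%E.
  rewrite -[X in G n X]setIT -integral_indic//; last exact: mobs.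
  have mF : measurable_fun setT (fun x : 'rV[R]_n => (\1_A (f0 + x) : R)%:E).
    apply/measurable_EFinP.
    apply: (measurableT_comp (f := (\1_A : 'rV[R]_n -> R))).
      exact: measurable_indic.
    by apply: measurable_fun_rVD => //; exact: measurable_id.
  have abc : lambda ^+ 2 + sigma ^+ 2 = (tau * s) ^+ 2.
    by rewrite lambda2 sigma2 exprMn s2; ring.
  have F0 (x : 'rV[R]_n) : (0 <= (\1_A (f0 + x) : R)%:E)%E by rewrite lee_fin.
  have := ge0_integral_std_gaussianD lambda0 sigma0 ts0 abc mF F0.
  rewrite /preimage => <-.
  (* Given [u], the inner integral is the probability of [A] for the signal [f0 + lambda *: u] at
     noise level [sigma], where coverage is assumed. *)
  apply: (@le_trans _ _ (\int[G n]_u (beta%:E + (\1_D u)%:E))%E).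
    apply: ge0_le_integral => //.
    - by move=> u _; apply: integral_ge0 => w _; exact: F0.
    - apply: (measurable_fun_fubini_tonelli_F (m2 := G n)
        (fun uw : 'rV[R]_n * 'rV[R]_n =>
          (\1_A (f0 + (lambda *: uw.1 + sigma *: uw.2)) : R)%:E)) => //.
      apply: (measurableT_comp mF); apply: measurable_fun_rVD.
        by apply: measurable_fun_rVZ; exact: measurable_fst.
      by apply: measurable_fun_rVZ; exact: measurable_snd.
    - by apply: emeasurable_funD => //; apply/measurable_EFinP; exact: measurable_indic.
    - move=> u _.
      have -> : (\int[G n]_w (\1_A (f0 + (lambda *: u + sigma *: w)))%:E =
          gaussian_law (f0 + lambda *: u) sigma A)%E.
        rewrite -[X in gaussian_law _ _ X]setIT -integral_indic//.
        rewrite ge0_integral_distribution//; last exact/measurable_EFinP.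
        by apply: eq_integral => w _; rewrite /= /observation addrA.
      apply: le_trans (gaussian_law_small_radius_le f0 r (cov _)) _.
      rewrite leeD2l// lee_fin !indicE.
      case: (boolP (f0 \in _)) => [/set_mem /= near0|_]; last by case: (_ \in _).
      rewrite mem_set//= /D /=.
      rewrite -(ler_pM2l (exprn_gt0 2 lambda0)) mulr_sumr.
      rewrite (eq_bigr (fun i => ((f0 + lambda *: u) ord0 i - f0 ord0 i) ^+ 2)); last first.
        by move=> i _; rewrite !mxE; ring.
      apply: (le_trans near0).
      have : lambda ^+ 2 * n%:R = (eta * n%:R + Num.sqrt n%:R) * tau ^+ 2.
        by rewrite lambda2 -vn; ring.
      lra.
  rewrite ge0_integralD//.
  - rewrite integral_cst// [X in (_ * X)%E]probability_setT mule1.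
    by rewrite integral_indic// setIT.
  - move=> u _; have := probability_le1 (gaussian_law f0 tau) (measurable_covered f0).
    by move/(le_trans cov0); rewrite !lee_fin; lra.
  - by apply/measurable_EFinP; exact: measurable_indic.
have := std_gaussian_small_ball (0 : 'rV[R]_n).
rewrite -/D => GD.
(* The chain becomes 1 - beta - alpha <= beta + 1/6 + 1/2, contrary to 2 beta + alpha < 1/36. *)
have D6 : (6^-1) ^+ n <= 6^-1 :> R by rewrite ler_iXnr//; lra.
have := le_trans PA (le_trans step1 (leeD2r _ (le_trans step2 (leeD2l _ GD)))).
by rewrite -!EFinD lee_fin; lra.
Qed.

End confidence_ball.

(** * Orthonormal bases of subspaces *)

Section orthonormal_rows.
Context {R : realType}.

Lemma rV_sum_sqr n (x : 'rV[R]_n) : \sum_i x ord0 i ^+ 2 = (x *m x^T) ord0 ord0.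
Proof. by rewrite mxE; apply: eq_bigr => i _; rewrite mxE expr2. Qed.

(** Gram-Schmidt, one vector at a time: [phi] lists the inner products with the rows already chosen.
    Its rank is at most k < dim S, so some nonzero vector of [S] is orthogonal to all of them. *)
Lemma orthonormal_rows_exist n (S : {vspace 'rV[R]_n}) k : (k <= \dim S)%N ->
  exists2 B : 'M[R]_(k, n), B *m B^T = 1%:M & forall g : 'rV_k, g *m B \in S.
Proof.
elim: k => [_|k IH ltkS].
  exists 0; first by apply/matrixP => -[].
  by move=> g; rewrite mulmx0 mem0v.
have [B BB BS] := IH (ltnW ltkS).
pose phi : 'Hom('rV[R]_n, 'rV[R]_k) := linfun (mulmxr B^T).
have : (0 < \dim (S :&: lker phi))%N.
  rewrite -(ltn_add2r (\dim (phi @: S))) add0n limg_ker_dim.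
  apply: leq_ltn_trans ltkS; apply: leq_trans (dimvS (subvf _)) _.
  by rewrite dimvf /dim/= mul1n.
rewrite lt0n dimv_eq0 -vpick0; set w := vpick _ => w0.
have /memv_capP[wS] : w \in (S :&: lker phi)%VS by exact: memv_pick.
rewrite memv_ker lfunE/= => /eqP wB.
pose s := \sum_i w ord0 i ^+ 2.
have s0 : 0 < s.
  rewrite lt0r sumr_ge0 ?andbT; last by move=> i _; exact: sqr_ge0.
  apply: contra w0 => /eqP /psumr_eq0P s0; apply/eqP/rowP => i; rewrite mxE.
  by apply/eqP; rewrite -sqrf_eq0 s0// => j _; exact: sqr_ge0.
pose e := (Num.sqrt s)^-1 *: w.
have eB : e *m B^T = 0 by rewrite -scalemxAl wB scaler0.
have ee : e *m e^T = 1%:M.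
  rewrite linearZ/= -scalemxAl -scalemxAr scalerA -invfM -expr2 sqr_sqrtr ?ltW//.
  apply/rowP => i; rewrite !ord1 mxE -rV_sum_sqr mulVf ?gt_eqF//.
  by rewrite mxE eqxx.
exists (col_mx e B).
  have Be : B *m e^T = 0 by rewrite -[LHS]trmxK trmx_mul trmxK eB trmx0.
  suff : col_mx e B *m (col_mx e B)^T = (1%:M : 'M[R]_(1 + k)) by [].
  by rewrite tr_col_mx mul_col_row ee eB Be BB -scalar_mx_block.
suff gS (g : 'rV[R]_(1 + k)) : g *m col_mx e B \in S by move=> g; exact: gS.
rewrite -[g]hsubmxK mul_row_col memvD//.
by rewrite [lsubmx _]mx11_scalar mul_scalar_mx !memvZ.
Qed.

(** The gap is the squared norm of the residual [z] of the projection onto the row space of [B]. *)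
Lemma bessel_inequality k n (B : 'M[R]_(k, n)) (x : 'rV[R]_n) : B *m B^T = 1%:M ->
  \sum_j (x *m B^T) ord0 j ^+ 2 <= \sum_i x ord0 i ^+ 2.
Proof.
move=> BB; pose z := x - x *m B^T *m B.
have : 0 <= \sum_i z ord0 i ^+ 2 by apply: sumr_ge0 => i _; exact: sqr_ge0.
suff -> : \sum_i z ord0 i ^+ 2 =
    \sum_i x ord0 i ^+ 2 - \sum_j (x *m B^T) ord0 j ^+ 2 by rewrite subr_ge0.
rewrite !rV_sum_sqr /z.
set p := x *m B^T.
have pE : B *m x^T = p^T by rewrite trmx_mul trmxK.
rewrite linearB/= mulmxBl !mulmxBr trmx_mul.
rewrite -(mulmxA p) pE mulmxA -/p -(mulmxA p) (mulmxA B) BB mul1mx.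
by rewrite subrr subr0 !mxE.
Qed.

Lemma sum_sqr_mul k n (B : 'M[R]_(k, n)) (g : 'rV[R]_k) : B *m B^T = 1%:M ->
  \sum_i (g *m B) ord0 i ^+ 2 = \sum_j g ord0 j ^+ 2.
Proof.
by move=> BB; rewrite !rV_sum_sqr trmx_mul -mulmxA (mulmxA B) BB mul1mx.
Qed.

End orthonormal_rows.

(** * The radius forced by the dimension of a subspace *)

Section dimension_lower_bound.
Context {R : realType}.
Notation G := (@std_gaussian R).
Variables (n k : nat) (ftilde : {mfun 'rV[R]_n >-> 'rV[R]_n}) (B : 'M[R]_(k, n)).
Hypothesis BB : B *m B^T = 1%:M.

Notation near r f := [set y | (eucl_norm (f - ftilde y) <= r)%R].

Lemma measurable_mulmx : measurable_fun setT (fun g : 'rV[R]_k => g *m B).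
Proof.
apply/measurable_fun_rVP => i; under [X in measurable_fun _ X]eq_fun do rewrite mxE.
apply: measurable_sum => j; apply: measurable_funM => //.
exact: measurable_coord.
Qed.

(* Comparison with the law at f = 0: the chi-square term is exp(|g|^2 / 4). *)
Lemma gaussian_law_near_le (g : 'rV[R]_k) (tau r c : R) : 0 < tau -> 0 < c ->
  (gaussian_law ((tau / 2 *: g) *m B) tau (near r ((tau / 2 *: g) *m B)) <=
   c%:E * G n [set x | (eucl_norm ((tau / 2 *: g) *m B - ftilde (tau *: x)) <= r)%R] +
   ((4 * c)^-1)%:E * (\prod_j expR (g ord0 j ^+ 2 / 4))%:E)%E.
Proof.
move=> tau0 c0; set f := _ *m B.
have mZ : measurable_fun setT (fun x : 'rV[R]_n => tau *: x).
  by apply: measurable_fun_rVZ; exact: measurable_id.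
have mA : measurable [set x | eucl_norm (f - ftilde (tau *: x)) <= r].
  by apply: measurable_eucl_norm_le => //; exact: measurableT_comp mZ.
(* In units of [tau] the signal is g B / 2, of squared norm |g|^2 / 4 because the rows of [B] are
   orthonormal. *)
have kE (i : 'I_n) := integral_normal_ratio_sqr_shift ((tau^-1 *: f) ord0 i).
have := std_gaussian_affine_preimage_le ltr01 c0 kE mA.
rewrite (_ : _ @^-1` _ = observation f tau @^-1` near r f); last first.
  apply/seteqP; split => x /=;
  by rewrite /observation scale1r scalerDr scalerA divff ?gt_eqF// scale1r.
move/le_trans; apply; rewrite leeD2l// -EFinM lee_fin mulrC -!expR_sum.
rewrite (_ : \sum_i _ = \sum_(j < k) g ord0 j ^+ 2 / 4)//.
rewrite -[RHS]mulr_suml -(sum_sqr_mul g BB) mulr_suml; apply: eq_bigr => i _.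
by rewrite /f -scalemxAl !mxE; field; rewrite gt_eqF.
Qed.

(** Projecting onto the row space of [B] does not increase distances, so [g] lies in a ball of R^k
    with center [b] and squared radius r^2 / (tau / 2)^2 <= k / 128. *)
Lemma std_gaussian_near_le (x : 'rV[R]_n) (tau r : R) : 0 < tau ->
  512 * r ^+ 2 <= k%:R * tau ^+ 2 ->
  (G k [set g | (eucl_norm ((tau / 2 *: g) *m B - x) <= r)%R] <= ((6^-1) ^+ k)%:E)%E.
Proof.
move=> tau0 rk; pose b := (tau / 2)^-1 *: (x *m B^T).
apply: le_trans (std_gaussian_small_ball b).
apply: le_measure; rewrite ?inE.
- have mg : measurable_fun setT (fun g : 'rV[R]_k => (tau / 2 *: g) *m B).
    apply: (measurableT_comp measurable_mulmx).
    by apply: measurable_fun_rVZ; exact: measurable_id.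
  exact: measurable_eucl_norm_le.
- by rewrite -[X in measurable X]setTI; apply: measurable_fun_le => //; exact: measurable_sqdist.
- move=> g /= /eucl_norm_le; move/(le_trans (bessel_inequality _ BB)).
  rewrite mulmxBl -mulmxA BB mulmx1.
  rewrite (eq_bigr (fun j => (tau / 2) ^+ 2 * (g ord0 j - b ord0 j) ^+ 2)); last first.
    by move=> j _; rewrite !mxE; field; rewrite gt_eqF.
  rewrite -mulr_sumr => near0.
  rewrite -(ler_pM2l (_ : 0 < (tau / 2) ^+ 2)); last by rewrite exprn_gt0// divr_gt0.
  by apply: (le_trans near0); lra.
Qed.

Lemma dimension_lower_bound (tau gamma r : R) : (0 < k)%N -> 0 < tau -> gamma < 1 / 36 ->
  (forall g : 'rV[R]_k,
    ((1 - gamma)%:E <= gaussian_law (g *m B) tau (near r (g *m B)))%E) ->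
  k%:R * tau ^+ 2 <= 512 * r ^+ 2.
Proof.
move=> k0 tau0 gamma36 cov; rewrite leNgt; apply/negP => small.
(* With this [c] the averaged chi-square term sqrt(2)^k / (4 c) is 1/4. *)
pose c : R := Num.sqrt 2 ^+ k.
have c0 : 0 < c by rewrite exprn_gt0// sqrtr_gt0.
pose Q := [set gx : 'rV[R]_k * 'rV[R]_n |
  eucl_norm ((tau / 2 *: gx.1) *m B - ftilde (tau *: gx.2)) <= r].
have mQ : measurable Q.
  apply: measurable_eucl_norm_le => //.
    apply: (measurableT_comp measurable_mulmx).
    by apply: measurable_fun_rVZ; exact: measurable_fst.
  apply: (measurableT_comp (measurable_funPT ftilde)).
  by apply: measurable_fun_rVZ; exact: measurable_snd.
have mQ1 : measurable_fun setT (fun gx => (\1_Q gx : R)%:E).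
  by apply/measurable_EFinP; exact: measurable_indic.
have mphi : measurable_fun setT (fun x : R => expR (x ^+ 2 / 4)).
  by apply: measurableT_comp => //; apply: measurable_funM.
pose E (g : 'rV[R]_k) := \prod_j expR (g ord0 j ^+ 2 / 4).
have mE : measurable_fun setT E := measurable_coord_prod (fun=> mphi).
have E0 g : 0 <= E g by apply: prodr_ge0 => j _; exact: expR_ge0.
have c4 : 0 <= (4 * c)^-1 by rewrite invr_ge0; lra.
have mI : measurable_fun setT (fun g => \int[G n]_x (\1_Q (g, x))%:E)%E.
  by apply: (measurable_fun_fubini_tonelli_F (m2 := G n) _ mQ1) => gx; rewrite lee_fin.
have I0 g : (0 <= \int[G n]_x (\1_Q (g, x))%:E)%E.
  by apply: integral_ge0 => x _; rewrite lee_fin.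
have : ((1 - gamma)%:E <= c%:E * \int[G k]_g \int[G n]_x (\1_Q (g, x))%:E +
    (4 * c)^-1%:E * \int[G k]_g (E g)%:E)%E.
  rewrite -(ge0_integralZl _ measurableT mI) ?lee_fin ?(ltW c0)//.
  rewrite -(ge0_integralZl _ measurableT (f := fun g => (E g)%:E)) ?lee_fin//; last 2 first.
  - exact/measurable_EFinP.
  - by move=> g _; rewrite lee_fin.
  rewrite -ge0_integralD//; last 4 first.
  - by move=> g _; rewrite mule_ge0// lee_fin ltW.
  - exact: emeasurable_funM.
  - by move=> g _; rewrite mule_ge0 ?lee_fin.
  - by apply: emeasurable_funM => //; exact/measurable_EFinP.
  apply: (@le_trans _ _ (\int[G k]_g cst (1 - gamma)%:E g)%E).
    by rewrite integral_cst// [X in (_ * X)%E]probability_setT mule1.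
  apply: ge0_le_integral => //.
  - by move=> g _; rewrite lee_fin; lra.
  - by apply: emeasurable_funD; apply: emeasurable_funM => //; exact/measurable_EFinP.
  - move=> g _; apply: (le_trans (cov _)).
    apply: (le_trans (gaussian_law_near_le g r tau0 c0)).
    rewrite leeD2r// lee_pmul2l ?lte_fin// -[X in G n X]setIT -integral_indic//.
    apply: measurable_eucl_norm_le => //.
    apply: (measurableT_comp (measurable_funPT ftilde)).
    by apply: measurable_fun_rVZ; exact: measurable_id.
have /= -> := ge0_integral_std_gaussian_prod (fun=> mphi)
  (fun (i : 'I_k) x => expR_ge0 _) (fun=> integral_normal_expR_sqr).
rewrite prodr_const card_ord -/c.
(* Once [x] is fixed first, the center [ftilde (tau *: x)] does not depend on [g], and the
   small-ball bound applies to the integral in [g]. *)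
rewrite (fubini_tonelli (m1 := G k) (m2 := G n) _ mQ1); last first.
  by move=> gx; rewrite lee_fin.
have : (\int[G n]_x \int[G k]_g (\1_Q (g, x))%:E <= ((6^-1) ^+ k)%:E)%E.
  apply: (@le_trans _ _ (\int[G n]_x cst ((6^-1) ^+ k)%:E x)%E); last first.
    by rewrite integral_cst// [X in (_ * X)%E]probability_setT mule1.
  apply: ge0_le_integral => //.
  - by move=> x _; apply: integral_ge0 => g _; rewrite lee_fin.
  - by apply: (measurable_fun_fubini_tonelli_G (m1 := G k) _ mQ1) => gx; rewrite lee_fin.
  - move=> x _.
    apply: le_trans (std_gaussian_near_le (ftilde (tau *: x)) tau0 (ltW small)).
    rewrite -[X in G k X]setIT -integral_indic//.
    apply: measurable_eucl_norm_le => //.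
    apply: (measurableT_comp measurable_mulmx).
    by apply: measurable_fun_rVZ; exact: measurable_id.
move=> small6 main.
(* This leads to 1 - gamma <= (sqrt(2) / 6)^k + 1/4 <= 1/2, where [0 < k] bounds the power by its
   base. *)
have := le_trans main (leeD2r _ (lee_wpmul2l (_ : 0 <= c%:E)%E small6)).
rewrite lee_fin (ltW c0) => /(_ isT).
rewrite -!EFinM -EFinD lee_fin /c -exprMn.
have s2 : Num.sqrt 2 <= 3 / 2 :> R.
  by rewrite -[leRHS]ger0_norm// -sqrtr_sqr ler_sqrt//; lra.
have s0 : 0 <= Num.sqrt 2 :> R := sqrtr_ge0 _.
have : (Num.sqrt 2 * 6^-1) ^+ k <= Num.sqrt 2 * 6^-1 :> R by rewrite ler_iXnr//; lra.
have cancel : (4 * Num.sqrt 2 ^+ k)^-1 * Num.sqrt 2 ^+ k = 4^-1 :> R.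
  by rewrite -/c; field; rewrite gt_eqF.
rewrite cancel; lra.
Qed.

End dimension_lower_bound.

(** * Choice of the constant and deduction of both parts *)

Theorem theorem3p1 (R : realType) (alpha beta : R)
    (alpha01 : 0 < alpha < 1) (beta01 : 0 < beta < 1)
    (alpha_beta : 2 * beta + alpha < 1 - expR (- (1 / 36))) :
  exists C : R, 0 < C /\
  forall (n : nat) (tau eta : R) (M : finType) (S : M -> {vspace 'rV[R]_n})
    (ftilde : {mfun 'rV[R]_n >-> 'rV[R]_n}) (rtilde : {mfun 'rV[R]_n >-> R}),
  let I := `[Num.sqrt (1 - eta) * tau, tau]%classic in
  let D := fun m : M => \dim (S m) in
  let N := fun m : M => (n - D m)%N in
  (1 <= n)%N -> 0 < tau -> 0 <= eta < 1 ->
  (forall y, 0 <= rtilde y) ->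
  (forall (f : 'rV[R]_n) (sigma : R), I sigma ->
    ((1 - beta)%:E <=
      gaussian_law f sigma [set y | eucl_ball (ftilde y) (rtilde y) f])%E) ->
  (forall r : M -> R,
    (forall m, 0 < r m /\
      forall sigma, I sigma ->
        ((1 - alpha)%:E <=
          ereal_inf [set gaussian_law f sigma [set y | (rtilde y <= r m)%R]
                    | f in [set` S m]])%E) ->
    forall m,
      C * Num.max (eta * (N m)%:R) (Num.max (D m)%:R (Num.sqrt (N m)%:R))
        * tau ^+ 2 <= r m ^+ 2) /\
  (forall r : 'rV[R]_n -> R,
    (forall (f : 'rV[R]_n) (sigma : R), I sigma ->
        ((1 - alpha)%:E <=
          gaussian_law f sigma [set y | (rtilde y <= r f)%R])%E) ->
    forall f,
      C * Num.max (eta * n%:R) (Num.sqrt n%:R) * tau ^+ 2 <= r f ^+ 2).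

Proof.
have ab36 : 2 * beta + alpha < 1 / 36.
  by have := expR_ge1Dx (- (1 / 36) : R); lra.
(* In 512 = 4 * 128, the factor 128 comes from the small-ball radius; the 4 comes from the squared
   diameter of a ball, or from the prior scale tau / 2 in the dimension bound. *)
exists (1 / 512); split=> // n tau eta M S ftilde rtilde I D N n0 tau0 eta01 rt0 cov.
have [eta0 eta1] := andP eta01.
have sigma1 : I (Num.sqrt (1 - eta) * tau).
  rewrite /I/= in_itv/= lexx/= ler_piMl//; first exact: ltW.
  by rewrite -[leRHS]sqrtr1 ler_sqrt; lra.
have Itau : I tau.
  by move: sigma1; rewrite /I/= !in_itv/= !lexx/= andbT.
have radius f0 r : (forall sigma, I sigma ->
      ((1 - alpha)%:E <= gaussian_law f0 sigma [set y | (rtilde y <= r)%R])%E) ->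
    (eta * n%:R + Num.sqrt n%:R) * tau ^+ 2 <= 512 * r ^+ 2.
  move=> rad; apply: (radius_lower_bound n0 tau0 eta01 ab36 (cov f0 tau Itau)).
    by move=> f; exact: cov.
  exact: rad.
have n_ge0 (k : nat) : 0 <= k%:R :> R := ler0n _ k.
have tau2 : 0 <= tau ^+ 2 := sqr_ge0 tau.
split=> [r hr m|r hr f]; last first.
  have := radius f (r f) (hr f); have := sqrtr_ge0 (n%:R : R).
  have : 0 <= eta * n%:R by rewrite mulr_ge0.
  move: (eta * _) (Num.sqrt _) => a b a0 b0 main.
  suff : Num.max a b * tau ^+ 2 <= (a + b) * tau ^+ 2 by lra.
  by rewrite ler_wpM2r// ge_max lerDl lerDr b0 a0.
have [r0 hrm] := hr m.
have radS f sigma : f \in S m -> I sigma ->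
    ((1 - alpha)%:E <= gaussian_law f sigma [set y | (rtilde y <= r m)%R])%E.
  by move=> fS Is; apply: le_trans (hrm _ Is) _; apply: ereal_inf_lbound; exists f.
(* Zero lies in every [S m], and N_m <= n, so the bound at f0 = 0 yields both terms in N_m. *)
have main := radius 0 (r m) (fun sigma => radS 0 sigma (mem0v _)).
have Dbound : (D m)%:R * tau ^+ 2 <= 512 * r m ^+ 2.
  have [->|D0] := posnP (D m).
    by rewrite mul0r mulr_ge0// sqr_ge0.
  have [B BB BS] := orthonormal_rows_exist (leqnn (\dim (S m))).
  (* When f is covered and the radius is at most r_m, f is within r_m of its estimate; the union
     bound makes the failure probability at most beta + alpha, which is below 1/36 since beta >
     0. *)
  apply: (dimension_lower_bound (ftilde := ftilde) BB D0 tau0 (gamma := beta + alpha)).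
    by have [] := andP beta01; lra.
  move=> g; rewrite opprD addrA.
  apply: le_trans (probability_setI_ge (measurable_covered ftilde rtilde _)
    (measurable_radius_le rtilde _) (cov _ _ Itau) (radS _ _ (BS g) Itau)) _.
  apply: le_measure; rewrite ?inE.
  - by apply: measurableI; [exact: measurable_covered|exact: measurable_radius_le].
  - exact: measurable_eucl_norm_le.
  - by move=> y [/= covered rad]; exact: le_trans covered rad.
have Nn : (N m)%:R <= n%:R :> R by rewrite ler_nat leq_subr.
have sqrtN : Num.sqrt (N m)%:R <= Num.sqrt n%:R :> R by rewrite ler_sqrt.
have etaN : eta * (N m)%:R <= eta * n%:R by rewrite ler_wpM2l.
have etaN0 : 0 <= eta * n%:R by rewrite mulr_ge0.
have := sqrtr_ge0 (n%:R : R) => sqrtn0.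
suff : Num.max (eta * (N m)%:R) (Num.max (D m)%:R (Num.sqrt (N m)%:R)) *
    tau ^+ 2 <= 512 * r m ^+ 2 by lra.
rewrite !maxr_pMl// !ge_max Dbound/=; apply/andP; split; apply: le_trans main.
  by rewrite ler_wpM2r//; lra.
by rewrite ler_wpM2r//; lra.
Qed.
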